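(* Let $|\Sigma|=2$, $n\ge 1$ and $d=\lfloor\frac{n+1}{2}\rfloor$. The algorithm IdentifyHMP (described in the context) correctly decides whether a probability distribution $\mathbf{P}:\Sigma^n\to[0,1]$ is due to a hidden Markov process on at most $d$ hidden states, and infers a hidden Markov process parametrization with at most $d$ hidden states, for all but a lower-dimensional subvariety of parametrizations in $\mathcal{H}_{d,+}$. That is, there is a subvariety $\mathcal{N}$ with $\dim(\mathcal{N}\cap\mathcal{H}_{d,+})<\dim\mathcal{H}_{d,+}$ such that: for every $\Theta\in\mathcal{H}_{d,+}\setminus\mathcal{N}$, on input $\mathbf{P}=\mathbf{f}_{\mathcal{H}_d,n}(\Theta)$ the algorithm prints 'HMP on $e$ hidden states' for some $e\le d$ and returns a stochastic parametrization of $\mathbf{P}$; and if $\mathbf{P}$ is not due to a hidden Markov process on at most $d$ hidden states, the algorithm prints 'No HMP on $d$ hidden states'.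
   Context: $\Sigma=\{a,b\}$; $'$ denotes transposition; $\mathbf{1}$ is the all-ones column vector; for matrices $T_a,T_b$ and $v=a_1\cdots a_m$, $T_v=T_{a_1}\cdots T_{a_m}$. $\mathcal{H}_{e,+}$ is the set of stochastic parametrizations $(M,E,\pi)$ of hidden Markov processes on $e$ hidden states: $M=[m_{s\bar s}]\in\mathbb{R}^{e\times e}$ and $E=[e_{sc}]\in\mathbb{R}^{e\times\Sigma}$ are nonnegative with unit row sums, and $\pi\in\mathbb{R}^e$ is a probability vector. Write $O_c=\mathrm{diag}(e_{1c},\dots,e_{ec})$ and $T_c=O_cM$ for $c\in\Sigma$; a parametrization is equivalently written $(M,O_a,O_b,\pi)$. The map $\mathbf{f}_{\mathcal{H}_e,n}$ sends it to $(\pi'T_v\mathbf{1})_{v\in\Sigma^n}$. $\mathbf{P}$ is due to a hidden Markov process on $e$ hidden states if $\mathbf{P}\in\mathbf{f}_{\mathcal{H}_e,n}(\mathcal{H}_{e,+})$. $\dim\mathcal{H}_{d,+}=d^2+d-1$. For $\mathbf{P}=(p(v))_{v\in\Sigma^n}$ and $|u|=m<n$ put $p(u)=\sum_{w\in\Sigma^{n-m}}p(uw)$. $\mathcal{P}_{p,k,l}=[p(vw)]_{|v|\le k,|w|\le l}$ is the matrix with rows indexed by strings of length at most $k$ and columns by strings of length at most $l$. Algorithm IdentifyHMP($\mathbf{P}$). For $e=1,2,\dots,d$ in turn: 1. If $\mathrm{rk}\,\mathcal{P}_{p,e-1,e-1}=\mathrm{rk}\,\mathcal{P}_{p,\lfloor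 n/2\rfloor,\lceil n/2\rceil}=\mathrm{rk}\,\mathcal{P}_{p,\lceil n/2\rceil,\lfloor n/2\rfloor}=e$ does not hold, go to the next $e$. 2. InferFinitaryParam: choose an invertible submatrix $V=[p(v_iw_j)]_{1\le i,j\le e}$ of $\mathcal{P}_{p,e-1,e-1}$; set $x_0'=(p(w_1),\dots,p(w_e))$, $y=V^{-1}(p(v_1),\dots,p(v_e))'$, $T^0_c=V^{-1}[p(v_icw_j)]_{1\le i,j\le e}$ for $c\in\Sigma$; choose an invertible $U$ with $U\mathbf{1}=y$; set $x=U'x_0$ and $T_c=U^{-1}T^0_cU$. 3. If $T_a+T_b$ is not invertible, or if $T_a(T_a+T_b)^{-1}$ is not diagonalizable with pairwise different eigenvalues, go to the next $e$. 4. InferHMMParam: choose an invertible $S\in\mathbb{C}^{e\times e}$ with $S\mathbf{1}=\mathbf{1}$ and $S^{-1}T_a(T_a+T_b)^{-1}S=\mathrm{diag}(\lambda_1,\dots,\lambda_e)$; set $M=S^{-1}(T_a+T_b)S$, $O_c=S^{-1}T_cS\,M^{-1}$ for $c\in\Sigma$, and $\pi=S'x$. 5. If $(M,O_a,O_b,\pi)$ is stochastic (lies in $\mathcal{H}_{e,+}$), print 'HMP on $e$ hidden states', return $(M,O_a,O_b,\pi)$ and stop; otherwise print 'No HMP on $d$ hidden states' and stop. If the loop ends without stopping, print 'No HMP on $d$ hidden states'.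
   Formalization: The algorithm as described does not say what happens in step 4 if no invertible S with S1=1 diagonalizing T_a(T_a+T_b)^{-1} exists (possible for e≥3 when P is not due to a hidden Markov process); it is taken to print 'No HMP on d hidden states' in that case. *)

(* Defs.v *)
From HB Require Import structures.
From mathcomp Require Import all_boot all_order all_algebra.
From mathcomp Require Import complex.
From mathcomp Require Import mpoly.
From mathcomp Require Import boolp classical_sets reals constructive_ereal ereal.

Set Implicit Arguments.
Unset Strict Implicit.
Unset Printing Implicit Defensive.

Import Order.TTheory GRing.Theory Num.Theory.

Local Open Scope classical_set_scope.
Local Open Scope ring_scope.

Notation Sigma := 'I_2.
Definition letter_a : Sigma := ord0.
Definition letter_b : Sigma := ord_max.

(* [E s c] is the probability of emitting [c] in state [s]. *)
Record hmp_param (R : realType) (e : nat) := HMPParam {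
  trans : 'M[R]_e;
  emis : 'M[R]_(e, 2);
  init : 'cV[R]_e
}.

Section Parametrizations.
Context {R : realType} {e : nat}.
Implicit Type Theta : hmp_param R e.

Definition stochastic_mx m k (A : 'M[R]_(m, k)) :=
  (forall i j, 0 <= A i j) /\ (forall i, \sum_j A i j = 1).

Definition stochastic_param : set (hmp_param R e) :=
  [set Theta | [/\ stochastic_mx (trans Theta), stochastic_mx (emis Theta)
                 & stochastic_mx (init Theta)^T]].

Definition O_mx Theta (c : Sigma) : 'M[R]_e := diag_mx (col c (emis Theta))^T.
Definition T_mx Theta (c : Sigma) : 'M[R]_e := O_mx Theta c *m trans Theta.

Definition word_mx (T : Sigma -> 'M[R]_e) (v : seq Sigma) : 'M[R]_e :=
  \big[mulmx/1%:M]_(c <- v) T c.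

Definition hmp_map n Theta : n.-tuple Sigma -> R := fun v =>
  ((init Theta)^T *m word_mx (T_mx Theta) v *m (const_mx 1 : 'cV[R]_e)) ord0 ord0.

Definition coords Theta : 'rV[R]_(e * e + e * 2 + e) :=
  row_mx (row_mx (mxvec (trans Theta)) (mxvec (emis Theta))) (init Theta)^T.
End Parametrizations.

Arguments stochastic_param R e : clear implicits.
Arguments hmp_map {R e} n Theta.

Section StringFunctions.
Context {R : realType} {n : nat}.
Implicit Type P : n.-tuple Sigma -> R.

Definition is_distribution P :=
  (forall v, 0 <= P v <= 1) /\ \sum_v P v = 1.

Definition due_to_hmp e P :=
  exists2 Theta, stochastic_param R e Theta & hmp_map n Theta = P.

(* For [size u <= n] the words [v] of length [n] with prefix [u] are exactly
   the [u ++ w] with [size w = n - size u]. *)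
Definition prob P (u : seq Sigma) : R :=
  \sum_(v : n.-tuple Sigma | prefix u v) P v.

(* [{bseq k of Sigma}] is the finite type of the strings of length at most k. *)
Definition hankel P k l :
    'M[R]_(#|{: {bseq k of Sigma}}|, #|{: {bseq l of Sigma}}|) :=
  \matrix_(i, j)
    prob P ((enum_val i : {bseq k of Sigma}) ++ (enum_val j : {bseq l of Sigma})).
End StringFunctions.

(* The dimension of a subset A of R^m is the Krull dimension of R[X]/I(A), that
   is, of its Zariski closure; it is -oo for the empty set. *)
Section Dimension.
Context {R : realType} {m : nat}.
Implicit Type A : set 'rV[R]_m.

Definition peval (f : {mpoly R[m]}) (x : 'rV[R]_m) : R := f.@[fun i => x ord0 i].

Definition algebraic A :=
  exists s : seq {mpoly R[m]},
    A = [set x | forall f, f \in s -> peval f x = 0].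

Definition vanishes_on A (f : {mpoly R[m]}) := forall x, A x -> peval f x = 0.

Definition prime_chain A k :=
  exists p : nat -> {pred {mpoly R[m]}},
    (forall i, (i <= k)%N ->
       [/\ idealr_closed (p i), prime_idealr_closed (p i)
         & forall f, vanishes_on A f -> f \in p i]) /\
    (forall i, (i < k)%N ->
       {subset p i <= p i.+1} /\ exists2 f, f \in p i.+1 & f \notin p i).

Definition zdim A : \bar R := ereal_sup [set (k%:R)%:E | k in prime_chain A].
End Dimension.

Inductive outcome (R : realType) :=
| PrintHMP e of hmp_param R e
| PrintNoHMP.
Arguments PrintHMP {R} e _.
Arguments PrintNoHMP {R}.

(* The free choices of the algorithm (V, U and S) are modelled by relations
   between input and output. *)
Section Algorithm.
Context {R : realType} {n : nat}.
Implicit Types (P : n.-tuple Sigma -> R) (e : nat).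

(* [n./2] and [uphalf n] are the floor and the ceiling of n / 2. *)
Definition rank_condition P e :=
  [/\ \rank (hankel P e.-1 e.-1) = e,
      \rank (hankel P n./2 (uphalf n)) = e
    & \rank (hankel P (uphalf n) n./2) = e].

Definition infer_finitary P e (x : 'cV[R]_e) (T : Sigma -> 'M[R]_e) :=
  exists (v w : 'I_e -> {bseq e.-1 of Sigma}) (U : 'M[R]_e),
    let V : 'M[R]_e := \matrix_(i, j) prob P (v i ++ w j) in
    let x0 : 'cV[R]_e := \col_j prob P (w j) in
    let y : 'cV[R]_e := invmx V *m \col_i prob P (v i) in
    let T0 c : 'M[R]_e := invmx V *m \matrix_(i, j) prob P (v i ++ c :: w j) in
    [/\ V \in unitmx, U \in unitmx, U *m const_mx 1 = y,
        x = U^T *m x0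
      & forall c, T c = invmx U *m T0 c *m U].

Definition diagonalizable_simple e (A : 'M[R[i]]_e) :=
  exists2 S : 'M[R[i]]_e, S \in unitmx &
  exists2 lam : 'rV[R[i]]_e, injective (lam ord0) &
    invmx S *m A *m S = diag_mx lam.

Definition toC m k (A : 'M[R]_(m, k)) : 'M[R[i]]_(m, k) :=
  map_mx (real_complex R) A.

Definition regular e (T : Sigma -> 'M[R]_e) :=
  T letter_a + T letter_b \in unitmx /\
  diagonalizable_simple
    (toC (T letter_a *m invmx (T letter_a + T letter_b))).

Definition infer_hmm e (x : 'cV[R]_e) (T : Sigma -> 'M[R]_e)
    (M : 'M[R[i]]_e) (O : Sigma -> 'M[R[i]]_e) (pi : 'cV[R[i]]_e) :=
  exists S : 'M[R[i]]_e,
    [/\ S \in unitmx, S *m const_mx 1 = const_mx 1 :> 'cV[R[i]]_e,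
        (exists lam : 'rV[R[i]]_e,
           invmx S *m toC (T letter_a *m invmx (T letter_a + T letter_b)) *m S
           = diag_mx lam),
        M = invmx S *m toC (T letter_a + T letter_b) *m S
      & (forall c, O c = invmx S *m toC (T c) *m S *m invmx M) /\
        pi = S^T *m toC x].

(* The matrices (M, O_a, O_b, pi) over C are those of a real parametrization. *)
Definition represents e (M : 'M[R[i]]_e) (O : Sigma -> 'M[R[i]]_e)
    (pi : 'cV[R[i]]_e) (Theta : hmp_param R e) :=
  [/\ M = toC (trans Theta), forall c, O c = toC (O_mx Theta c)
    & pi = toC (init Theta)].

(* [identify_from d P e o]: the loop, entered at the value [e] of its counter,
   can end with outcome [o]. *)
Inductive identify_from (d : nat) P : nat -> outcome R -> Prop :=
| IdEnd e : (d < e)%N -> identify_from d P e PrintNoHMP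
| IdRank e o : (e <= d)%N -> ~ rank_condition P e ->
    identify_from d P e.+1 o -> identify_from d P e o
| IdRegular e x T o : (e <= d)%N -> rank_condition P e ->
    infer_finitary P x T -> ~ @regular e T ->
    identify_from d P e.+1 o -> identify_from d P e o
| IdAccept e x T M O pi Theta : (e <= d)%N -> rank_condition P e ->
    infer_finitary P x T -> @regular e T -> infer_hmm x T M O pi ->
    represents M O pi Theta -> stochastic_param R e Theta ->
    identify_from d P e (PrintHMP e Theta)
| IdReject e x T M O pi : (e <= d)%N -> rank_condition P e ->
    infer_finitary P x T -> @regular e T -> infer_hmm x T M O pi ->
    ~ (exists2 Theta, represents M O pi Theta & stochastic_param R e Theta) ->
    identify_from d P e PrintNoHMP
(* For some P no invertible S with S 1 = 1 diagonalizes T_a (T_a + T_b)^-1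
   (an eigenvector component of the vector 1 may vanish). Then InferHMMParam
   yields no stochastic parametrization, so the test that follows it fails. *)
| IdNoS e x T : (e <= d)%N -> rank_condition P e ->
    infer_finitary P x T -> @regular e T ->
    ~ (exists M O pi, infer_hmm x T M O pi) ->
    identify_from d P e PrintNoHMP.

Definition IdentifyHMP (d : nat) P (o : outcome R) := identify_from d P 1 o.
End Algorithm.

(* Main.v *)
Require Import Defs.
From mathcomp Require Import all_boot all_order all_algebra.
From mathcomp Require Import fingroup perm complex mpoly.
From mathcomp Require Import boolp classical_sets reals constructive_ereal ereal.
From mathcomp Require Import zify ring.

(* The exceptional set is the zero set of the polynomial [genericity]: it says
   that M is singular, or two states emit the letter a with equal probability,
   or the Hankel matrix [p(a^(i+j))] is singular. The stochastic
   parametrizations form a convex set, so their vanishing ideal is prime: a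
   product vanishing on a segment has a factor vanishing on it. As the polynomial
   is not in this ideal, any chain of primes for the exceptional part extends
   downwards by one; strictness of the dimension inequality then needs only that
   R[X_1, ..., X_m] has finite Krull dimension, which follows from the algebraic
   dependence of any m + 1 polynomials.

   If the rank conditions hold, rows and columns of the Hankel matrices are
   determined by those of V, so that an induction on words recovers P from the
   finitary parametrization; hence whatever is accepted is a parametrization of
   P. On a generic hidden Markov process the rank conditions single out e = d,
   where the inferred T_a and T_b are the given ones conjugated by some Q with
   Q 1 = 1. Then T_a (T_a + T_b)^-1 is conjugate to O_a, whose diagonal entries
   are distinct, and every admissible S only permutes the hidden states. *)

Set Implicit Arguments.
Unset Strict Implicit.
Unset Printing Implicit Defensive.

Import Order.TTheory GRing.Theory Num.Theory.

Local Open Scope classical_set_scope.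
Local Open Scope ring_scope.

(** * Krull dimension *)

Section KrullDimension.
Context {K : fieldType} {m : nat}.
Implicit Types (c : seq nat -> K) (x : {mpoly K[m]}) (xs : seq {mpoly K[m]}).
Implicit Type p : nat -> {pred {mpoly K[m]}}.

Fixpoint words D k : seq (seq nat) :=
  if k is k'.+1 then [seq t :: s | t <- iota 0 D, s <- words D k'] else [:: [::]].

Lemma size_words D k : size (words D k) = (D ^ k)%N.
Proof. by elim: k => //= k IH; rewrite size_allpairs size_iota IH expnS. Qed.

Lemma uniq_words D k : uniq (words D k).
Proof.
elim: k => //= k IH; apply: allpairs_uniq => //; first exact: iota_uniq.
by move=> [a b] [a' b'] _ _ /= [-> ->].
Qed.

Lemma words_bound D k s : s \in words D k -> size s = k /\ all (ltn^~ D) s.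
Proof.
elim: k s => [|k IH] s /=; first by rewrite inE => /eqP ->.
move=> /allpairsP[[t s'] /= [tD /IH[<- s'D] ->]].
by split=> //=; move: tD; rewrite mem_iota => /andP[_ ->].
Qed.

(** The nested form splits off the powers of the head of [xs], matching the induction along a prime
    chain; [power_combE] flattens it for counting. *)
Fixpoint power_comb D c xs : {mpoly K[m]} :=
  if xs is x :: xs' then
    \sum_(t < D) x ^+ t * power_comb D (fun s => c (nat_of_ord t :: s)) xs'
  else (c [::])%:A.

Fixpoint power_monomial xs (s : seq nat) : {mpoly K[m]} :=
  match xs, s with
  | x :: xs', t :: s' => x ^+ t * power_monomial xs' s'
  | _, _ => 1
  end.

Lemma power_combE D c xs :
  power_comb D c xs = \sum_(s <- words D (size xs)) c s *: power_monomial xs s.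
Proof.
elim: xs c => [|x xs IH] c /=; first by rewrite big_seq1.
have -> : iota 0 D = index_iota 0 D by rewrite /index_iota subn0.
rewrite big_allpairs_dep big_mkord.
apply: eq_bigr => t _; rewrite IH mulr_sumr.
by apply: eq_bigr => s _; rewrite scalerAr.
Qed.

Lemma power_comb0 D c xs :
  (forall s, size s = size xs -> all (ltn^~ D) s -> c s = 0) ->
  power_comb D c xs = 0.
Proof.
move=> c0; rewrite power_combE big_seq big1 // => s /words_bound[s1 s2].
by rewrite c0 // scale0r.
Qed.

(** Carrying the witnesses of strictness as data allows an algebraic relation to be stated among
    exactly these elements. *)
Definition strict_prime_chain p xs :=
  (forall i, (i <= size xs)%N -> idealr_closed (p i) /\ prime_idealr_closed (p i))
  /\ (forall i, (i < size xs)%N ->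
       [/\ {subset p i <= p i.+1}, xs`_i \in p i.+1 & xs`_i \notin p i]).

Lemma idealr_closed_add (I : {pred {mpoly K[m]}}) u v :
  idealr_closed I -> u \in I -> v \in I -> u + v \in I.
Proof. by case=> _ _ h uI vI; move: (h 1 u v uI vI); rewrite mul1r. Qed.

Lemma idealr_closed_mul (I : {pred {mpoly K[m]}}) a u :
  idealr_closed I -> u \in I -> a * u \in I.
Proof. by case=> I0 _ h uI; move: (h a u 0 uI I0); rewrite addr0. Qed.

Lemma idealr_closed_sum (I : {pred {mpoly K[m]}}) (J : Type) (r : seq J)
    (P : pred J) F :
  idealr_closed I -> (forall i, P i -> F i \in I) -> \sum_(i <- r | P i) F i \in I.
Proof.
move=> cI FI; apply: (big_ind (fun u => u \in I)) => //; first by case: cI.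
by move=> u v; apply: idealr_closed_add.
Qed.

Lemma prime_idealr_exp (I : {pred {mpoly K[m]}}) u t :
  idealr_closed I -> prime_idealr_closed I -> u \notin I -> u ^+ t \notin I.
Proof.
move=> [_ I1 _] pI uI; elim: t => [|t IH]; first by rewrite expr0.
by rewrite exprS; apply/negP => /pI /orP[]; apply/negP.
Qed.

(* The lexicographically least exponent of a nonzero combination in the bottom
   prime has a coefficient that, going up the chain, ends up in the top prime:
   at each step x^t (g + x h) in p_0 and x notin p_0 give g in p_1, as x in p_1. *)
Lemma power_comb_notin D c xs p s :
  strict_prime_chain p xs -> size s = size xs -> all (ltn^~ D) s -> c s != 0 ->
  power_comb D c xs \notin p 0%N.
Proof.
elim: xs p c s => [|x xs IH] p c s [idp pxs].
  (* A nonzero constant is a unit, so it would put 1 into the prime. *)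
  move=> /size0nil -> _ c0 /=; have [[I0 I1 cI] _] := idp 0%N isT.
  apply/negP => cin; move/negP: I1; apply.
  have := idealr_closed_mul ((c [::])^-1)%:A (idp 0%N isT).1 cin.
  by rewrite -scalerAl mul1r scalerA mulVf // scale1r.
case: s => // t0 s0 /= [sz0] /andP[t0D s0D] c0.
pose nz t := `[< exists s, [/\ size s = size xs, all (ltn^~ D) s & c (t :: s) != 0] >].
have exnz : exists t, nz t by exists t0; apply/asboolP; exists s0.
case: (ex_minnP exnz) => t /asboolP[s [ss sD cs]] tmin.
have tD : (t < D)%N by apply: leq_ltn_trans (tmin t0 _) t0D; apply/asboolP; exists s0.
pose G u := power_comb D (fun s => c (u :: s)) xs.
have G0 u : (u < t)%N -> G u = 0.
  move=> ut; apply: power_comb0 => s' ss' s'D; apply/eqP/negP => /negP cn.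
  by move: ut; rewrite ltnNge tmin //; apply/asboolP; exists s'.
have -> : \sum_(u < D) x ^+ u * power_comb D (fun s1 => c (nat_of_ord u :: s1)) xs
   = x ^+ t * \sum_(u < D | (t <= u)%N) x ^+ (u - t) * G u.
  rewrite mulr_sumr [RHS]big_mkcond /=; apply: eq_bigr => u _.
  case: leqP => tu; first by rewrite mulrA -exprD subnKC.
  by rewrite -/(G u) G0 // mulr0.
have [id0 pr0] := idp 0%N isT; have [id1 pr1] := idp 1%N isT.
have [sub01 xin xnin] := pxs 0%N isT.
apply/negP => /pr0 /orP[]; first by apply/negP; exact: prime_idealr_exp.
move=> /sub01; rewrite (bigD1 (Ordinal tD)) //= subnn expr0 mul1r => Gin.
have IH' : G t \notin p 1%N.
  apply: (IH (fun i => p i.+1) (fun s1 => c (t :: s1)) s) => //.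
  by split => i isz; [apply: idp | apply: (pxs i.+1)].
move/negP: IH'; apply.
set h := (X in _ + X) in Gin.
have hin : h \in p 1%N.
  apply: idealr_closed_sum => // u /andP[tu utD].
  have ut : (t < u)%N by rewrite ltn_neqAle tu andbT eq_sym.
  rewrite mulrC -(prednK (n := u - t)) ?subn_gt0 // exprSr mulrA.
  exact: idealr_closed_mul.
have -> : G t = -1 * h + (G t + h) by rewrite mulN1r addrC addrK.
by apply: idealr_closed_add => //; apply: idealr_closed_mul.
Qed.

(** Since [msize] is the total degree plus one, and 0 at 0, bounds by a successor act as degree
    bounds that also cover the zero polynomial. *)
Lemma msize_mul_leq x y a b :
  (msize x <= a.+1)%N -> (msize y <= b.+1)%N -> (msize (x * y) <= (a + b).+1)%N.
Proof.
have [->|x0] := eqVneq x 0; first by rewrite mul0r msize0.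
have [->|y0] := eqVneq y 0; first by rewrite mulr0 msize0.
rewrite msizeM // => xa yb; have := leq_add xa yb; rewrite addnS addSn.
by case: (_ + _)%N => [|k] /=.
Qed.

Lemma msize_exp_leq x a t : (msize x <= a.+1)%N -> (msize (x ^+ t) <= (a * t).+1)%N.
Proof.
move=> xa; elim: t => [|t IH]; first by rewrite expr0 msize1.
by rewrite exprS mulnS; apply: msize_mul_leq.
Qed.

Lemma msize_power_monomial xs a D s :
  (forall x, x \in xs -> msize x <= a.+1)%N -> all (ltn^~ D.+1) s ->
  (msize (power_monomial xs s) <= (a * D * size xs).+1)%N.
Proof.
elim: xs s => [|x xs IH] [|t s] /=; rewrite ?msize1 // => xsa /andP[tD sD].
rewrite mulnS; apply: msize_mul_leq.
  apply: leq_trans (msize_exp_leq t (xsa x _)) _; rewrite ?mem_head //.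
  by rewrite ltnS leq_mul2l -ltnS tD orbT.
by apply: IH => // y yxs; apply: xsa; rewrite inE yxs orbT.
Qed.

(* Counting monomials: the D^(m+1) products of powers with exponents below D
   lie in a space of dimension (C D)^m, with C independent of D. *)
Lemma power_relation xs : size xs = m.+1 ->
  exists D c s, [/\ size s = size xs, all (ltn^~ D) s, c s != 0
                  & power_comb D c xs = 0].
Proof.
move=> szxs; pose a := (\max_(x <- xs) msize x)%N.
have xsa x : x \in xs -> (msize x <= a.+1)%N.
  by move=> xxs; apply: leqW; rewrite /a (big_rem x) //= leq_maxl.
(* Each product has degree at most a (D - 1) (m + 1) < C D = B, and D > C^m gives D^(m+1) > (C D)^m:
   the rows of [A] outnumber its columns. *)
pose C := (a * m.+1).+1; pose D := (C ^ m).+1; pose B := (C * D)%N.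
pose w := words D (size xs); pose N := size w.
pose W := #|{: {ffun 'I_m -> 'I_B}}|.
pose mon (f : {ffun 'I_m -> 'I_B}) : 'X_{1..m} := [multinom nat_of_ord (f i) | i < m].
pose A : 'M[K]_(N, W) :=
  \matrix_(i, j) (power_monomial xs (nth [::] w i))@_(mon (enum_val j)).
have WN : (W < N)%N.
  rewrite /W /N card_ffun !card_ord size_words szxs /B expnMn expnS.
  by rewrite ltn_pmul2r ?expn_gt0.
have kerN0 : kermx A != 0.
  rewrite -mxrank_eq0 mxrank_ker subn_eq0 -ltnNge.
  exact: leq_ltn_trans (rank_leq_col A) WN.
have /rowV0Pn[u /sub_kermxP uA u0] := kerN0.
have [i ui] : exists i, u ord0 i != 0.
  by move/rV0Pn: u0.
(* The kernel vector is extended by 0 to sequences outside [w]. *)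
pose c s := if insub (index s w) is Some j then u ord0 j else 0.
have cE (j : 'I_N) : c (nth [::] w j) = u ord0 j.
  rewrite /c index_uniq ?uniq_words // ?valK //.
have iw : nth [::] w i \in w by apply: mem_nth.
have [s1 s2] := words_bound iw.
exists D, c, (nth [::] w i); split => //; first by rewrite cE.
rewrite power_combE -/w (big_nth [::]) big_mkord.
apply/mpolyP => k; rewrite mcoeff0 raddf_sum /=.
(* A monomial with an exponent at least B has too large a degree to occur; the others are columns of
   [A]. *)
have [kB|kB] := boolP [forall i, k i < B]%N; last first.
  apply: big1 => j _; rewrite mcoeffZ.
  have /words_bound[t1 t2] : nth [::] w j \in w by apply: mem_nth.
  have sz := msize_power_monomial xsa t2.
  rewrite memN_msupp_eq0 ?mulr0 //; apply: msize_mdeg_ge.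
  move: kB; rewrite negb_forall => /existsP[l]; rewrite -leqNgt => Bk.
  apply: leq_trans sz _; apply: leq_trans (_ : k l <= mdeg k)%N; last first.
    by rewrite mdegE (bigD1 l) //= leq_addr.
  apply: leq_trans Bk; rewrite /B /D /C szxs; nia.
have := congr1 (fun M : 'rV_W => M ord0 (enum_rank [ffun i => Ordinal (forallP kB i)])) uA.
rewrite !mxE => uA0; rewrite -[RHS]uA0; apply: eq_bigr => j _.
rewrite mcoeffZ cE !mxE enum_rankK; congr (_ * _@__).
by apply/mnmP => l; rewrite mnmE ffunE.
Qed.

End KrullDimension.

(** * Zariski dimension and convex sets *)

Section ZariskiDimension.
Context {R : realType} {m : nat}.
Implicit Types (A B : set 'rV[R]_m) (f g : {mpoly R[m]}) (x y : 'rV[R]_m).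

Lemma pevalM f g x : peval (f * g) x = peval f x * peval g x.
Proof. exact: mevalM. Qed.

(** On a segment, vanishing becomes a question about roots in one variable. *)
Lemma peval_on_line f x y :
  exists q : {poly R}, forall t, q.[t] = peval f ((1 - t) *: x + t *: y).
Proof.
pose l i : {poly R} := (x ord0 i)%:P + (y ord0 i - x ord0 i) *: 'X.
exists (\sum_(k <- msupp f) f@_k *: \prod_i l i ^+ k i) => t.
rewrite /peval mevalE horner_sum; apply: eq_bigr => k _.
rewrite hornerZ horner_prod; congr (_ * _); apply: eq_bigr => i _.
by rewrite horner_exp /l !hornerE !mxE; congr (_ ^+ _); ring.
Qed.

Lemma poly_nonroot_itv (q : {poly R}) :
  q != 0 -> exists2 t, 0 <= t <= 1 & q.[t] != 0.
Proof.
move=> q0; apply: contrapT => noroot.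
(* The points 1/(i+1) are [size q] distinct elements of [0, 1], more than q can have as roots. *)
pose rs : seq R := [seq i.+1%:R^-1 | i <- iota 0 (size q)].
have := @max_poly_roots _ q rs q0; rewrite size_map size_iota ltnn.
move=> h; suff : false by []; apply: h.
  apply/allP => _ /mapP[i _ ->]; apply: contrapT => /negP nr; apply: noroot.
  exists (i.+1%:R^-1); last by [].
  by rewrite invr_ge0 ler0n /= invf_le1 ?ltr0n // ler1n.
rewrite map_inj_uniq ?iota_uniq // => i j /invr_inj /eqP.
by rewrite eqr_nat eqSS => /eqP.
Qed.

Definition convex_subset A := forall x y (t : R),
  0 <= t <= 1 -> A x -> A y -> A ((1 - t) *: x + t *: y).

(** If f is nonzero at x and g at y, both restrict to nonzero polynomials on the segment from x to
    y, which stays in [A]; their product has a nonroot there. *)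
Lemma convex_vanishing_prime A f g : convex_subset A ->
  vanishes_on A (f * g) -> vanishes_on A f \/ vanishes_on A g.
Proof.
move=> cA fg; apply: contrapT => /not_orP[/existsNP[x /not_implyP[Ax fx]]].
move=> /existsNP[y /not_implyP[Ay gy]].
have [q qE] := peval_on_line f x y; have [r rE] := peval_on_line g x y.
have q0 : q != 0.
  apply/eqP => q0; apply: fx.
  by have := qE 0; rewrite q0 horner0 subr0 scale1r scale0r addr0 => <-.
have r0 : r != 0.
  apply/eqP => r0; apply: gy.
  by have := rE 1; rewrite r0 horner0 subrr scale1r scale0r add0r => <-.
have [t t01] := poly_nonroot_itv (mulf_neq0 q0 r0).
by rewrite hornerM qE rE -pevalM fg ?eqxx //; apply: cA.
Qed.

Definition vanishing_ideal A : {pred {mpoly R[m]}} := fun f => `[< vanishes_on A f >].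

Lemma vanishing_idealE A f : (f \in vanishing_ideal A) = `[< vanishes_on A f >].
Proof. by []. Qed.

Lemma vanishing_ideal_closed A : A !=set0 -> idealr_closed (vanishing_ideal A).
Proof.
case=> x Ax; split.
- by rewrite vanishing_idealE; apply/asboolP => y _; exact: meval0.
- rewrite vanishing_idealE; apply/asboolP => /(_ _ Ax).
  by rewrite /peval meval1; apply/eqP; rewrite oner_eq0.
- move=> a u v; rewrite !vanishing_idealE => /asboolP uA /asboolP vA.
  apply/asboolP => y Ay; rewrite /peval mevalD mevalM.
  by move: (uA _ Ay) (vA _ Ay); rewrite /peval => -> ->; rewrite mulr0 addr0.
Qed.

(** The first m + 1 steps of a longer chain would supply m + 1 polynomials. Their algebraic relation
    has value 0, yet [power_comb_notin] keeps that value out of the bottom prime. *)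
Lemma prime_chain_leq A k : prime_chain A k -> (k <= m)%N.
Proof.
move=> [p [idp incp]]; rewrite leqNgt; apply/negP => mk.
have /choice[F FP] : forall i, exists f, (i < k)%N -> f \in p i.+1 /\ f \notin p i.
  move=> i; case: (ltnP i k) => [ik|]; last by exists 0.
  by have [_ [f f1 f2]] := incp i ik; exists f.
pose xs := mkseq F m.+1.
have szxs : size xs = m.+1 by rewrite size_mkseq.
have [D [c [s [s1 s2 cs rel]]]] := power_relation szxs.
have chain : strict_prime_chain p xs.
  split=> i; rewrite szxs => im.
    by have [] := idp i (leq_trans im mk).
  have ik : (i < k)%N := leq_trans im mk.
  have [sub _] := incp i ik; have [f1 f2] := FP i ik.
  by rewrite nth_mkseq.
have := power_comb_notin chain s1 s2 cs; rewrite rel.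
by have [[-> _ _] _ _] := idp 0%N isT.
Qed.

Lemma zdim_lt A B f : A `<=` B -> B !=set0 -> convex_subset B ->
  vanishes_on A f -> ~ vanishes_on B f -> (zdim A < zdim B)%E.
Proof.
move=> AB B0 cB fA fB.
have prB : prime_idealr_closed (vanishing_ideal B).
  move=> u v; rewrite !vanishing_idealE => /asboolP /(convex_vanishing_prime cB).
  by case=> h; apply/orP; [left|right]; apply/asboolP.
have chain0 : prime_chain B 0.
  exists (fun=> vanishing_ideal B); split => // i _; split => //.
    exact: vanishing_ideal_closed.
  by move=> g gB; apply/asboolP.
have exB : exists k, `[< prime_chain B k >] by exists 0%N; apply/asboolP.
have bB k : `[< prime_chain B k >] -> (k <= m)%N.
  by move=> /asboolP; exact: prime_chain_leq.
case: (ex_maxnP exB bB) => K /asboolP chK maxK.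
(* The vanishing ideal of [B] goes below the chain, and f separates it from the old bottom. *)
have chS k : prime_chain A k -> prime_chain B k.+1.
  move=> [p [idp incp]].
  exists (fun i => if i is j.+1 then p j else vanishing_ideal B); split.
  - move=> [|i] ik.
      split => //; first exact: vanishing_ideal_closed.
      by move=> g gB; apply/asboolP.
    have [p1 p2 p3] := idp i ik; split => // g gB; apply: p3 => x /AB; exact: gB.
  - move=> [|i] ik; last exact: incp.
    have [_ _ p3] := idp 0%N isT; split.
      move=> g; rewrite vanishing_idealE => /asboolP gB.
      by apply: p3 => x /AB; exact: gB.
    by exists f; [exact: p3 | rewrite vanishing_idealE; apply/asboolP].
(* The subtraction is in the reals: for K = 0 it gives -1, still a strict bound, as [A] then has no
   chain at all. *)
apply: (@Order.POrderTheory.le_lt_trans _ _ (K%:R - 1)%:E).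
  apply: ge_ereal_sup => _ [k /chS chk <-]; rewrite lee_fin lerBrDr natr1.
  by rewrite ler_nat maxK //; apply/asboolP.
apply: (@Order.POrderTheory.lt_le_trans _ _ (K%:R)%:E).
  by rewrite lte_fin ltrBlDr ltrDl ltr01.
by apply: ereal_sup_ubound; exists K.
Qed.

End ZariskiDimension.

(** * Correctness of accepted parametrizations *)

Section RankFactorization.
Context {K : fieldType}.

(** The rows chosen by f have rank e, hence span the row space: A = B (rows f). Restricting to the
    columns g identifies B. *)
Lemma unit_submatrix_factor m n e (A : 'M[K]_(m, n)) (f : 'I_e -> 'I_m)
    (g : 'I_e -> 'I_n) :
  (\rank A <= e)%N -> mxsub f g A \in unitmx ->
  A = colsub g A *m invmx (mxsub f g A) *m rowsub f A.
Proof.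
move=> rA Vu; pose V := mxsub f g A.
have VE : V = colsub g (rowsub f A) by apply/matrixP => i j; rewrite !mxE.
have ref : (e <= \rank (rowsub f A))%N.
  have /eqP reV : row_free V by rewrite row_free_unit.
  rewrite -{1}reV VE; have -> : colsub g (rowsub f A) = rowsub f A *m colsub g 1%:M.
    by rewrite mulmx_colsub mulmx1.
  exact: mxrankM_maxl.
have sub : (A <= rowsub f A)%MS.
  have [_ <-] := mxrank_leqif_sup (rowsub_sub f A).
  by rewrite eqn_leq (mxrankS (rowsub_sub f A)) (leq_trans rA).
case/submxP: sub => B AB.
have gA : colsub g A = B *m V by rewrite {1}AB VE mulmx_colsub.
by rewrite gA -/V mulmxK.
Qed.

Lemma unit_submatrix_exists m n e (A : 'M[K]_(m, n)) : \rank A = e ->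
  exists f g, mxsub f g A \in (unitmx : {pred 'M[K]_e}).
Proof.
move=> <-; pose f := maxrankfun A; pose B := rowsub f A.
have full : row_full B^T by rewrite /row_full mxrank_tr eq_maxrowsub.
exists f, (fullrankfun full).
have -> : mxsub f (fullrankfun full) A = (rowsub (fullrankfun full) B^T)^T.
  by apply/matrixP => i j; rewrite !mxE.
by rewrite unitmx_tr fullrowsub_unit.
Qed.

(** This supplies the U with U 1 = y of InferFinitaryParam. A rank-one map taking u to y is
    completed to an invertible one, in the row-vector convention, whence the transposes. *)
Lemma unitmx_with_image e (u y : 'cV[K]_e) :
  u != 0 -> y != 0 -> exists2 U, U \in unitmx & U *m u = y.
Proof.
move=> u0 y0; have /matrix0Pn[i [k ui]] := u0.
have r1 (z : 'cV[K]_e) : z != 0 -> \rank z^T = 1%N.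
  by move=> z0; rewrite rank_rV trmx_eq0 z0.
pose f : 'M[K]_e := (u i k)^-1 *: delta_mx i ord0 *m y^T.
have uf : u^T *m f = y^T.
  rewrite /f mulmxA -scalemxAr.
  have -> : u^T *m delta_mx i ord0 = (u i k)%:M.
    by rewrite -colE [LHS]mx11_scalar !mxE (ord1 k).
  by rewrite scale_scalar_mx mulVf // mul1mx.
have [|g gu ug] := @complete_unitmx _ _ _ u^T f; first by rewrite uf !r1.
exists g^T; first by rewrite unitmx_tr.
by apply: trmx_inj; rewrite trmx_mul trmxK -ug.
Qed.

End RankFactorization.

(** * Products of matrices along words *)

Section WordMatrices.
Context {R : realType} {e : nat}.
Implicit Types (T : Sigma -> 'M[R]_e).

Lemma word_mx_nil T : word_mx T [::] = 1%:M.
Proof. by rewrite /word_mx big_nil. Qed.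

Lemma word_mx_cons T c v : word_mx T (c :: v) = T c *m word_mx T v.
Proof. by rewrite /word_mx big_cons. Qed.

Lemma word_mx_cat T v w : word_mx T (v ++ w) = word_mx T v *m word_mx T w.
Proof.
elim: v => [|c v IH]; first by rewrite word_mx_nil mul1mx.
by rewrite cat_cons !word_mx_cons IH mulmxA.
Qed.

Lemma word_mx_rcons T v c : word_mx T (rcons v c) = word_mx T v *m T c.
Proof. by rewrite -cats1 word_mx_cat word_mx_cons word_mx_nil mulmx1. Qed.

Lemma word_mx_conj T U v : U \in unitmx ->
  word_mx (fun c => invmx U *m T c *m U) v = invmx U *m word_mx T v *m U.
Proof.
move=> Uu; elim: v => [|c v IH].
  by rewrite !word_mx_nil mulmx1 mulVmx.
by rewrite !word_mx_cons IH !mulmxA mulmxK.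
Qed.

Lemma eq_word_mx T T' v : T =1 T' -> word_mx T v = word_mx T' v.
Proof. by move=> TT; apply: eq_bigr. Qed.

End WordMatrices.

(** * Entries of Hankel matrices *)

Section HankelMatrices.
Context {R : realType} {n : nat}.
Implicit Types (P : n.-tuple Sigma -> R) (e k l : nat).

Lemma prob_full P (v : n.-tuple Sigma) : prob P v = P v.
Proof.
rewrite /prob (bigD1 v) ?prefix_refl //= big1 ?addr0 // => w.
case/andP => /prefixP[s ws] wv; case/eqP: wv; apply/val_inj => /=.
have := congr1 size ws; rewrite size_cat !size_tuple => sz.
have /size0nil s0 : size s = 0%N by lia.
by rewrite ws s0 cats0.
Qed.

Lemma prob_nil P : prob P [::] = \sum_v P v.
Proof. by apply: eq_bigl => v; rewrite prefix0s. Qed.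

(** The rank factorization is read off at one entry. Only the lengths of the v_i and w_j are
    bounded, so one V serves Hankel matrices of several shapes. *)
Lemma hankel_factor P k l e (v w : 'I_e -> seq Sigma) a b :
  let V : 'M[R]_e := \matrix_(i, j) prob P (v i ++ w j) in
  (\rank (hankel P k l) <= e)%N -> V \in unitmx ->
  (forall i, size (v i) <= k)%N -> (forall j, size (w j) <= l)%N ->
  (size a <= k)%N -> (size b <= l)%N ->
  prob P (a ++ b) =
    ((\row_j prob P (a ++ w j)) *m invmx V *m (\col_i prob P (v i ++ b))) ord0 ord0.
Proof.
move=> V rk Vu vk wl ak bl.
pose f i := enum_rank (Bseq (vk i) : {bseq k of Sigma}).
pose g j := enum_rank (Bseq (wl j) : {bseq l of Sigma}).
pose ia := enum_rank (Bseq ak : {bseq k of Sigma}).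
pose ib := enum_rank (Bseq bl : {bseq l of Sigma}).
have VE : mxsub f g (hankel P k l) = V.
  by apply/matrixP => i j; rewrite !mxE !enum_rankK.
have fact := @unit_submatrix_factor _ _ _ _ (hankel P k l) f g rk.
rewrite VE in fact; have {}fact := fact Vu.
have -> : \row_j prob P (a ++ w j) = row ia (colsub g (hankel P k l)).
  by apply/rowP => j; rewrite !mxE !enum_rankK.
have -> : \col_i prob P (v i ++ b) = col ib (rowsub f (hankel P k l)).
  by apply/colP => i; rewrite !mxE !enum_rankK.
rewrite -row_mul colE mulmxA -row_mul -fact -colE.
by rewrite !mxE !enum_rankK.
Qed.

End HankelMatrices.

(** The inductive step along a word: the inverse of M inside O_c cancels against the M of T_c = O_c
    M. *)
Lemma conj_mul_step (K : fieldType) e (S M A B : 'M[K]_e) :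
  S \in unitmx -> M \in unitmx ->
  invmx S *m A *m S *m invmx M *m M *m (invmx S *m B *m S) =
    invmx S *m (A *m B) *m S.
Proof. by move=> Su Mu; rewrite mulmxKV // !mulmxA mulmxK. Qed.

(** * Soundness and termination of the algorithm *)

Section Correctness.
Context {R : realType} {n : nat}.
Implicit Types (P : n.-tuple Sigma -> R) (e : nat).

(** The word is cut after floor(n/2) letters. The prefix is built up letter by letter through the
    floor-by-ceiling Hankel matrix, the suffix through the ceiling-by-floor one; a last
    factorization through V joins them, and U cancels because U 1 = y. *)
Lemma infer_finitary_correct P e (x : 'cV[R]_e) T (u : n.-tuple Sigma) :
  (e <= uphalf n)%N -> rank_condition P e -> infer_finitary P x T ->
  (x^T *m word_mx T u *m (const_mx 1 : 'cV[R]_e)) ord0 ord0 = P u.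
Proof.
move=> ed [_ rkl rlk] [v [w [U]]] /=.
set V := \matrix_(i, j) prob P (v i ++ w j).
set x0 := \col_j prob P (w j).
set y := invmx V *m _.
pose T0 c : 'M[R]_e := invmx V *m \matrix_(i, j) prob P (v i ++ c :: w j).
case=> Vu Uu Uy -> TE.
set k := n./2 in rkl rlk *; set l := uphalf n in ed rkl rlk *.
have kl : (k + l)%N = n by rewrite /k /l uphalf_half; lia.
have lk : (l <= k.+1)%N by rewrite /k /l uphalf_half; case: odd.
have kl' : (k <= l)%N by rewrite /k /l uphalf_half leq_addl.
have vs i : (size (v i) <= e.-1)%N := size_bseq (v i).
have ws i : (size (w i) <= e.-1)%N := size_bseq (w i).
have ep (i : 'I_e) : (0 < e)%N by case: i => [[]] //; case: (e).
have vk i : (size (v i) <= k)%N by have := vs i; have := ep i; lia.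
have wl j : (size (w j) <= l)%N by have := ws j; have := ep j; lia.
have wk j : (size (w j) <= k)%N by have := ws j; have := ep j; lia.
have vl i : (size (v i) <= l)%N by have := vs i; have := ep i; lia.
have rkl' : (\rank (hankel P k l) <= e)%N by rewrite rkl.
have rlk' : (\rank (hankel P l k) <= e)%N by rewrite rlk.
have rowE a : (size a <= k.+1)%N -> \row_j prob P (a ++ w j) = x0^T *m word_mx T0 a.
  elim/last_ind: a => [|a c IH] ak.
    by rewrite word_mx_nil mulmx1; apply/rowP => j; rewrite !mxE.
  have {}ak : (size a <= k)%N by rewrite size_rcons in ak.
  rewrite word_mx_rcons mulmxA -IH; last exact: leqW.
  apply/rowP => j.
  have cwl : (size (c :: w j) <= l)%N by have := ws j; have := ep j; rewrite /=; lia.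
  have := hankel_factor rkl' Vu vk wl ak cwl => fac.
  rewrite [LHS]mxE cat_rcons fac.
  rewrite /T0 mulmxA !mxE; apply: eq_bigr => i _.
  by rewrite !mxE.
(* The bound k + 1 matters: for odd n the suffix has length l = k + 1. *)
have colE b : (size b <= k.+1)%N ->
    invmx V *m \col_i prob P (v i ++ b) = word_mx T0 b *m y.
  elim: b => [|c b IH] bk.
    rewrite word_mx_nil mul1mx /y; congr (_ *m _).
    by apply/colP => i; rewrite !mxE cats0.
  rewrite word_mx_cons -mulmxA -IH; last exact: ltnW.
  rewrite /T0 -!mulmxA; congr (_ *m _); apply/colP => i.
  have vcl : (size (rcons (v i) c) <= l)%N.
    by have := vs i; have := ep i; rewrite size_rcons; lia.
  have := hankel_factor rlk' Vu vl wk vcl bk => fac.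
  rewrite [LHS]mxE -cat_rcons fac.
  rewrite -mulmxA !mxE; apply: eq_bigr => j _.
  by rewrite !mxE cat_rcons.
have -> : word_mx T u = invmx U *m word_mx T0 u *m U.
  by rewrite -word_mx_conj //; apply: eq_word_mx.
rewrite trmx_mul trmxK -!mulmxA Uy !mulmxA mulmxK //.
rewrite -prob_full -(cat_take_drop k u).
have a1 : size (take k u) = k by rewrite size_takel // size_tuple; lia.
have b1 : size (drop k u) = l by rewrite size_drop size_tuple; lia.
have := @hankel_factor _ _ P k l e v w (take k u) (drop k u) rkl' Vu vk wl.
rewrite a1 b1 => /(_ (leqnn _) (leqnn _)) ->; congr (_ ord0 ord0).
rewrite word_mx_cat rowE ?a1 // -!mulmxA; congr (_ *m (_ *m _)).
by rewrite colE ?b1.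
Qed.

(** The delicate choice is U, which requires y to be nonzero. Factoring the entry of the empty word
    writes p([::]) as a row times y, and p([::]) is nonzero. *)
Lemma infer_finitary_exists P e : prob P [::] != 0 -> (e <= uphalf n)%N ->
  rank_condition P e -> exists x T, @infer_finitary R n P e x T.
Proof.
move=> p0 ed [re rkl _].
have [f0 [g0 Vu]] := unit_submatrix_exists re.
pose v i : {bseq e.-1 of Sigma} := enum_val (f0 i).
pose w i : {bseq e.-1 of Sigma} := enum_val (g0 i).
pose V : 'M[R]_e := \matrix_(i, j) prob P (v i ++ w j).
have {}Vu : V \in unitmx.
  by have -> : V = mxsub f0 g0 (hankel P e.-1 e.-1) by apply/matrixP => i j; rewrite !mxE.
pose y := invmx V *m (\col_i prob P (v i)).
have rkl' : (\rank (hankel P n./2 (uphalf n)) <= e)%N by rewrite rkl.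
have vs i : (size (v i) <= e.-1)%N := size_bseq (v i).
have ws i : (size (w i) <= e.-1)%N := size_bseq (w i).
have ep (i : 'I_e) : (0 < e)%N by case: i => [[]] //; case: (e).
have kl : (uphalf n <= (n./2).+1)%N by rewrite uphalf_half; case: odd.
have vk i : (size (v i) <= n./2)%N by have := vs i; have := ep i; lia.
have wl j : (size (w j) <= uphalf n)%N by have := ws j; have := ep j; lia.
have := @hankel_factor _ _ P _ _ e v w [::] [::] rkl' Vu vk wl isT isT.
rewrite -mulmxA.
have -> : \col_i prob P (v i ++ [::]) = \col_i prob P (v i).
  by apply/colP => i; rewrite !mxE cats0.
rewrite -/V -/y => y1.
have y0 : y != 0.
  apply: contraNneq p0 => y0; move: y1; rewrite y0 mulmx0 cats0 => ->.
  by rewrite mxE.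
have u0 : const_mx 1 != 0 :> 'cV[R]_e.
  have /matrix0Pn[i _] := y0.
  by apply/matrix0Pn; exists i, ord0; rewrite mxE oner_eq0.
have [U Uu Uy] := unitmx_with_image u0 y0.
exists (U^T *m \col_j prob P (w j)).
exists (fun c => invmx U *m (invmx V *m \matrix_(i, j) prob P (v i ++ c :: w j)) *m U).
by exists v, w, U; split.
Qed.

Lemma toC_mul m p q (A : 'M[R]_(m, p)) (B : 'M[R]_(p, q)) :
  toC (A *m B) = toC A *m toC B.
Proof. exact: map_mxM. Qed.

Lemma toC_unit m (A : 'M[R]_m) : (toC A \in unitmx) = (A \in unitmx).
Proof. exact: map_unitmx. Qed.

Lemma toC_inj m p : injective (@toC R m p).
Proof. exact: map_mx_inj. Qed.

Lemma toC_one e : toC (const_mx 1 : 'cV[R]_e) = const_mx 1.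
Proof. by apply/matrixP => i j; rewrite !mxE. Qed.

(** The word matrices get conjugated by S; S 1 = 1 and pi = S' x absorb the outer factors. The
    identity is proved over the complex numbers and descends by injectivity of [toC]. *)
Lemma infer_hmm_correct e (x : 'cV[R]_e) T M O pi (Theta : hmp_param R e)
    (u : n.-tuple Sigma) :
  regular T -> infer_hmm x T M O pi -> represents M O pi Theta ->
  hmp_map n Theta u = (x^T *m word_mx T u *m (const_mx 1 : 'cV[R]_e)) ord0 ord0.
Proof.
move=> [Tu _] [S [Su S1 _ ME [OE piE]]] [MT OT piT].
have Mu : M \in unitmx.
  by rewrite ME unitmx_mul Su andbT unitmx_mul unitmx_inv Su toC_unit.
have TE v : toC (word_mx (T_mx Theta) v) = invmx S *m toC (word_mx T v) *m S.
  elim: v => [|c v IH].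
    by rewrite !word_mx_nil /toC !map_mx1 mulmx1 mulVmx.
  rewrite !word_mx_cons [in LHS]toC_mul [in RHS]toC_mul IH.
  rewrite [toC (T_mx _ _)]toC_mul -OT -MT OE.
  exact: conj_mul_step.
congr (fun_of_matrix _ _ _); apply: toC_inj.
rewrite [in LHS]toC_mul [X in X *m _]toC_mul TE toC_one.
have -> : toC (init Theta)^T = toC x^T *m S.
  by rewrite /toC -!map_trmx -/(toC _) -piT piE trmx_mul trmxK.
rewrite [in RHS]toC_mul [X in _ = X *m _]toC_mul toC_one.
by rewrite !mulmxA mulmxK // -!mulmxA S1.
Qed.

(** Induction on the number of remaining passes, each test being decided classically. *)
Lemma identify_exists d P e : (d <= uphalf n)%N -> prob P [::] != 0 ->
  exists o, identify_from d P e o.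
Proof.
move=> dn p0; have [k] := ubnP (d.+1 - e); elim: k e => // k IH e.
rewrite ltnS => ek; have [ed|de] := leqP e d; last by exists PrintNoHMP; apply: IdEnd.
have [o next] : exists o, identify_from d P e.+1 o by apply: IH; lia.
have [rc|nrc] := pselect (rank_condition P e); last by exists o; apply: IdRank.
have [x [T fin]] := infer_finitary_exists p0 (leq_trans ed dn) rc.
have [reg|nreg] := pselect (regular T); last by exists o; apply: IdRegular fin nreg _.
have [[M [O [pi hmm]]]|nhmm] := pselect (exists M O pi, infer_hmm x T M O pi); last first.
  by exists PrintNoHMP; apply: IdNoS fin reg nhmm.
have [[Theta rep sto]|nst] := pselect
    (exists2 Theta, represents M O pi Theta & stochastic_param R e Theta).
  by exists (PrintHMP e Theta); exact: (IdAccept ed rc fin reg hmm rep sto).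
by exists PrintNoHMP; apply: IdReject fin reg hmm nst.
Qed.

(** This holds for every run, whatever the choices. If P is not due to a small process, only
    rejection remains; for a generic process rejection is excluded separately. *)
Lemma identify_sound d P e o : (d <= uphalf n)%N -> (0 < e)%N ->
  identify_from d P e o ->
  o = PrintNoHMP \/ exists e' (Theta : hmp_param R e'),
    [/\ (e <= e' <= d)%N, o = PrintHMP e' Theta, rank_condition P e',
        stochastic_param R e' Theta & hmp_map n Theta = P].
Proof.
move=> dn + run; elim: run => {e o}.
- by left.
- move=> e o ed _ _ IH e0; have [->|[e' [Theta [ee' -> rc st eq]]]] := IH isT; first by left.
  right; exists e', Theta; split=> //; lia.
- move=> e x T o ed _ _ _ _ IH e0.
  have [->|[e' [Theta [ee' -> rc st eq]]]] := IH isT; first by left.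
  right; exists e', Theta; split=> //; lia.
- move=> e x T M O pi Theta ed rc fin reg hmm rep sto e0; right.
  exists e, Theta; split => //; first by rewrite leqnn.
  apply: funext => u; rewrite (infer_hmm_correct _ reg hmm rep).
  by apply: infer_finitary_correct rc fin; apply: leq_trans dn.
- by left.
- by left.
Qed.

End Correctness.

(** * Generic hidden Markov processes *)

Section HmpStringFunction.
Context {R : realType} {n d : nat} (Theta : hmp_param R d).
Context (stoTheta : stochastic_param R d Theta).
Local Notation P := (hmp_map n Theta).
Local Notation T := (T_mx Theta).
Local Notation one := (const_mx 1 : 'cV[R]_d).

Lemma sum_T_mx : T letter_a + T letter_b = trans Theta.
Proof.
have [_ [_ E1] _] := stoTheta.
rewrite /T_mx -mulmxDl; have -> : O_mx Theta letter_a + O_mx Theta letter_b = 1%:M.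
  apply/matrixP => i j; rewrite !mxE; case: eqVneq => [_|]; last by rewrite addr0.
  rewrite -[RHS](E1 i) big_ord_recl big_ord1 !mulr1n.
  by congr (_ + emis Theta i _); apply/val_inj.
by rewrite mul1mx.
Qed.

Lemma trans_one : trans Theta *m one = one.
Proof.
have [[_ M1] _ _] := stoTheta; apply/colP => i; rewrite !mxE -[RHS](M1 i).
by apply: eq_bigr => j _; rewrite mxE mulr1.
Qed.

Lemma prob_rcons (Q : n.-tuple Sigma -> R) u : (size u < n)%N ->
  prob Q u = prob Q (rcons u letter_a) + prob Q (rcons u letter_b).
Proof.
move=> un; rewrite /prob.
rewrite (partition_big (fun v : n.-tuple Sigma => nth letter_a v (size u)) predT) //=.
rewrite big_ord_recl big_ord1; congr (_ + _); apply: eq_bigl => v;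
  rewrite !prefixE size_rcons (take_nth letter_a) ?size_tuple // eqseq_rcons //.
Qed.

(** Induction downwards from length n: T_a + T_b = M fixes the vector 1, so summing over the last
    letter shortens the word. *)
Lemma prob_hmp u : (size u <= n)%N ->
  prob P u = ((init Theta)^T *m word_mx T u *m one) ord0 ord0.
Proof.
have [k] := ubnP (n - size u)%N; elim: k u => // k IH u uk un.
have [un'|nu] := ltnP (size u) n; last first.
  have su : size u == n by rewrite eqn_leq un.
  by rewrite -[u]/(tval (Tuple su)) prob_full.
rewrite prob_rcons // !IH ?size_rcons //; try lia.
rewrite !word_mx_rcons.
set X := _ *m (_ *m T letter_a) *m _; set Y := _ *m (_ *m T letter_b) *m _.
have <- : (X + Y) ord0 ord0 = X ord0 ord0 + Y ord0 ord0 by rewrite mxE.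
rewrite {}/X {}/Y; congr (fun_of_matrix _ _ _); rewrite -mulmxDl -mulmxDr -mulmxDr sum_T_mx.
by rewrite -!mulmxA trans_one.
Qed.

Lemma prob_hmp_nil : prob P [::] = 1.
Proof.
have [_ _ [_ pi1]] := stoTheta.
rewrite prob_hmp // word_mx_nil mulmx1 mxE -[RHS](pi1 ord0).
by apply: eq_bigr => i _; rewrite !mxE mulr1.
Qed.

Lemma prob_hmp_cat u w : (size u + size w <= n)%N ->
  prob P (u ++ w) =
    ((init Theta)^T *m word_mx T u *m (word_mx T w *m one)) ord0 ord0.
Proof. by move=> uw; rewrite prob_hmp ?size_cat // word_mx_cat !mulmxA. Qed.

(** Forward vectors here and backward vectors in [col_states] factor Hankel matrices through the d
    hidden states. *)
Definition row_states k (v : 'I_k -> seq Sigma) : 'M[R]_(k, d) :=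
  \matrix_i ((init Theta)^T *m word_mx T (v i)).

Definition col_states k (w : 'I_k -> seq Sigma) : 'M[R]_(d, k) :=
  \matrix_(i, j) (word_mx T (w j) *m one) i ord0.

(** Used with A = 1 for the numbers p(v_i w_j) and with A = T_c for p(v_i c w_j). *)
Lemma row_col_states k l (v : 'I_k -> seq Sigma) (w : 'I_l -> seq Sigma) A :
  row_states v *m A *m col_states w = \matrix_(i, j)
   ((init Theta)^T *m word_mx T (v i) *m (A *m (word_mx T (w j) *m one))) ord0 ord0.
Proof.
apply/matrixP => i j; rewrite [RHS]mxE -mulmxA mxE [RHS]mxE.
apply: eq_bigr => s _; rewrite [in LHS]mxE; congr (_ * _).
by rewrite !mxE; apply: eq_bigr => t _; rewrite [in LHS]mxE.
Qed.

Lemma hankel_rank_leq k l : (k + l <= n)%N -> (\rank (hankel P k l) <= d)%N.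
Proof.
move=> kl; have -> : hankel P k l =
    row_states (fun i => val (enum_val i : {bseq k of Sigma})) *m 1%:M *m
    col_states (fun i => val (enum_val i : {bseq l of Sigma})).
  rewrite row_col_states; apply/matrixP => i j; rewrite [LHS]mxE [RHS]mxE mul1mx.
  rewrite prob_hmp_cat //.
  by apply: leq_trans (leq_add (size_bseq _) (size_bseq _)) kl.
by apply: leq_trans (mxrankM_maxl _ _) _; rewrite mulmx1 rank_leq_col.
Qed.

(** The words a^i with i < d have length at most d - 1, so this is a submatrix of each Hankel matrix
    in the rank condition for e = d. *)
Definition letter_a_hankel : 'M[R]_d :=
  \matrix_(i, j) prob P (nseq i letter_a ++ nseq j letter_a).

Lemma hankel_rank k l : letter_a_hankel \in unitmx ->
  (d.-1 <= k)%N -> (d.-1 <= l)%N -> (k + l <= n)%N -> \rank (hankel P k l) = d.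
Proof.
move=> Hu dk dl kl; apply/eqP; rewrite eqn_leq hankel_rank_leq //=.
have sz m (i : 'I_d) : (d.-1 <= m)%N -> (size (nseq i letter_a) <= m)%N.
  by move=> dm; rewrite size_nseq; have := ltn_ord i; lia.
pose f i := enum_rank (Bseq (sz k i dk) : {bseq k of Sigma}).
pose g i := enum_rank (Bseq (sz l i dl) : {bseq l of Sigma}).
have subE : mxsub f g (hankel P k l) = letter_a_hankel.
  by apply/matrixP => i j; rewrite !mxE !enum_rankK.
rewrite -{1}(mxrank_unit Hu) -subE.
have -> : mxsub f g (hankel P k l) = rowsub f (hankel P k l) *m colsub g 1%:M.
  by rewrite mulmx_colsub mulmx1; apply/matrixP => i j; rewrite !mxE.
exact: leq_trans (mxrankM_maxl _ _) (mxrankS (rowsub_sub _ _)).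
Qed.

(** With A and B the forward and backward matrices, V = A B, so T0_c = B^-1 T_c B and Q = B U. The
    words v_i c w_j have length at most 2d - 1, whence the bound on n. *)
Lemma infer_finitary_hmp (x : 'cV[R]_d) S : (0 < d)%N -> (d.*2.-1 <= n)%N ->
  infer_finitary P x S ->
  exists Q, [/\ Q \in unitmx, Q *m one = one, x = Q^T *m init Theta
              & forall c, S c = invmx Q *m T c *m Q].
Proof.
move=> d0 dn [v [w [U]]] /=; set V := \matrix_(i, j) _; set x0 := \col_j prob P (w j).
case=> Vu Uu Uy -> SE.
have vs i : (size (v i) <= d.-1)%N := size_bseq (v i).
have ws i : (size (w i) <= d.-1)%N := size_bseq (w i).
pose A := row_states v; pose B := col_states w.
have VE : V = A *m B.
  rewrite -[A]mulmx1 row_col_states; apply/matrixP => i j; rewrite [LHS]mxE [RHS]mxE mul1mx.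
  by rewrite prob_hmp_cat //; have := vs i; have := ws j; lia.
have [Au Bu] : A \in unitmx /\ B \in unitmx.
  by apply/andP; rewrite -unitmx_mul -VE.
have x0E : x0 = B^T *m init Theta.
  apply: trmx_inj; rewrite trmx_mul trmxK; apply/rowP => j.
  rewrite [LHS]mxE [LHS]mxE prob_hmp; last by have := ws j; lia.
  rewrite -mulmxA [LHS]mxE [RHS]mxE; apply: eq_bigr => i _.
  by congr (_ * _); rewrite [RHS]mxE.
have yE : \col_i prob P (v i) = A *m one.
  apply/colP => i; rewrite [LHS]mxE prob_hmp; last by have := vs i; lia.
  rewrite [LHS]mxE [RHS]mxE; apply: eq_bigr => j _.
  by rewrite [row_states _ _ _]mxE !mxE.
have TE c : \matrix_(i, j) prob P (v i ++ c :: w j) = A *m T c *m B.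
  rewrite row_col_states; apply/matrixP => i j; rewrite [LHS]mxE [RHS]mxE.
  rewrite prob_hmp_cat /=; last by have := vs i; have := ws j; lia.
  by rewrite word_mx_cons !mulmxA.
have BV : invmx V *m A = invmx B.
  by rewrite VE -[LHS](mulmxK Bu) -[_ *m A *m B]mulmxA mulVmx ?unitmx_mul ?Au // mul1mx.
exists (B *m U); split.
- by rewrite unitmx_mul Bu.
- by rewrite -mulmxA Uy yE (mulmxA (invmx V)) BV mulmxA mulmxV // mul1mx.
- by rewrite x0E trmx_mul mulmxA.
- move=> c; rewrite SE TE !mulmxA -[invmx U *m _ *m A]mulmxA BV.
  have BUu : B *m U \in unitmx by rewrite unitmx_mul Bu.
  congr (_ *m _ *m _ *m _ *m _); apply: (can_inj (mulmxK BUu)).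
  by rewrite [RHS]mulVmx // mulmxA mulmxKV // mulVmx.
Qed.

End HmpStringFunction.

Arguments letter_a_hankel {R} n {d} Theta.

(** * Conjugation and diagonalizers *)

Section Conjugation.
Context {K : fieldType} {d : nat}.
Implicit Types (A M N Q S W : 'M[K]_d).

Lemma conj_unitmx M Q : Q \in unitmx -> M \in unitmx ->
  invmx Q *m M *m Q \in unitmx.
Proof. by move=> Qu Mu; rewrite unitmx_mul Qu andbT unitmx_mul unitmx_inv Qu. Qed.

Lemma conj_quotient A M Q : Q \in unitmx -> M \in unitmx ->
  invmx Q *m (A *m M) *m Q *m invmx (invmx Q *m M *m Q) = invmx Q *m A *m Q.
Proof.
move=> Qu Mu; have Nu := conj_unitmx Qu Mu.
by apply: (can_inj (mulmxK Nu)); rewrite mulmxKV // !mulmxA mulmxK.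
Qed.

Lemma conj_conj A Q S : Q \in unitmx -> S \in unitmx ->
  invmx S *m (invmx Q *m A *m Q) *m S = invmx (Q *m S) *m A *m (Q *m S).
Proof.
move=> Qu Su; have QSu : Q *m S \in unitmx by rewrite unitmx_mul Qu.
rewrite !mulmxA; congr (_ *m _ *m _ *m _); apply: (can_inj (mulmxK QSu)).
by rewrite [RHS]mulVmx // mulmxA mulmxKV // mulVmx.
Qed.

Lemma conj_invmx A Q : Q \in unitmx ->
  invmx (invmx Q) *m (invmx Q *m A *m Q) *m invmx Q = A.
Proof. by move=> Qu; rewrite invmxK !mulmxA mulmxK // mulmxV // mul1mx. Qed.

Lemma perm_mx_conj (s : 'S_d) A :
  invmx (perm_mx s) *m A *m perm_mx s = \matrix_(i, j) A ((s^-1)%g i) ((s^-1)%g j).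
Proof.
rewrite -[in X in _ *m X](invgK s) -col_permE.
have -> : invmx (perm_mx s) = perm_mx (s^-1)%g :> 'M[K]_d.
  apply: (can_inj (mulmxK (unitmx_perm _ s))).
  by rewrite mulVmx ?unitmx_perm // -perm_mxM mulVg perm_mx1.
by rewrite -row_permE; apply/matrixP => i j; rewrite !mxE.
Qed.

(* The eigenvectors of a diagonal matrix with distinct diagonal entries are the
   multiples of the unit vectors; the row sums fix the multiples to 1. *)
Lemma diagonalizer_perm_mx (al lam : 'rV[K]_d) W :
  injective (al ord0) -> W \in unitmx ->
  W *m const_mx 1 = const_mx 1 :> 'cV[K]_d ->
  invmx W *m diag_mx al *m W = diag_mx lam -> exists s : 'S_d, W = perm_mx s.
Proof.
move=> al_inj Wu W1 WD.
have entry i j : al ord0 i * W i j = W i j * lam ord0 j.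
  have : diag_mx al *m W = W *m diag_mx lam by rewrite -WD !mulmxA mulmxV // mul1mx.
  by move=> /matrixP/(_ i j); rewrite mul_diag_mx mul_mx_diag !mxE.
have rowsum i : \sum_j W i j = 1.
  have := congr1 (fun z : 'cV_d => z i ord0) W1; rewrite !mxE => <-.
  by apply: eq_bigr => j _; rewrite mxE mulr1.
have /choice[f fP] : forall i, exists j, W i j != 0.
  move=> i; apply: contrapT => /forallNP W0.
  have := rowsum i; rewrite big1 => [/esym/eqP|j _]; first by rewrite oner_eq0.
  by apply/eqP; have /negP := W0 j; rewrite negbK.
have alE i j : W i j != 0 -> al ord0 i = lam ord0 j.
  by move=> Wij; apply: (mulIf Wij); rewrite entry mulrC.
have f_inj : injective f.
  by move=> i i' ff; apply: al_inj; rewrite (alE _ _ (fP i)) (alE _ _ (fP i')) ff.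
(* [f] is bijective, so j = f (g j), and i and g j both carry the eigenvalue [lam] at j;
   distinctness gives i = g j. *)
have Wz i j : j != f i -> W i j = 0.
  move=> jf; apply/eqP; apply: contraNT jf => Wij.
  have [g _ gK] := injF_bij f_inj.
  have := fP (g j); rewrite gK => /alE; rewrite -(alE _ _ Wij) => /al_inj <-.
  by rewrite gK.
exists (perm f_inj); apply/matrixP => i j; rewrite !mxE permE.
have [<-|] := eqVneq (f i) j; last by rewrite eq_sym => /Wz.
rewrite -[RHS](rowsum i) (bigD1 (f i)) //= big1 ?addr0 // => k kf.
exact: Wz.
Qed.

End Conjugation.

(** * Acceptance of generic processes *)

Section GenericAcceptance.
Context {R : realType} {n d : nat} (Theta : hmp_param R d).
Context (stoTheta : stochastic_param R d Theta).
Context (transu : trans Theta \in unitmx).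
Context (emis_inj : injective (fun s => emis Theta s letter_a)).
Context (hankelu : letter_a_hankel n Theta \in unitmx).
Context (d0 : (0 < d)%N) (dn : d = uphalf n).
Local Notation P := (hmp_map n Theta).
Local Notation T := (T_mx Theta).

Let nE : n = (n./2 + uphalf n)%N.
Proof. by rewrite uphalf_half addnC -addnA addnn odd_double_half. Qed.

(** The two Hankel matrices of sizes floor and ceiling of n / 2 have rank d whatever e is, so no
    other e can pass. *)
Lemma rank_condition_hmp e : rank_condition P e <-> e = d.
Proof.
have le1 : (d.-1 <= n./2)%N by rewrite dn uphalf_half; case: odd => //=; lia.
have le2 : (d.-1 <= uphalf n)%N by rewrite -dn leq_pred.
have rk := hankel_rank stoTheta hankelu.
split=> [[_ rkl _]|->].
  by rewrite -rkl rk // -nE.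
split; rewrite rk //; rewrite ?[(uphalf n + _)%N]addnC -?nE //.
by move: le1 le2; lia.
Qed.

Definition permute_states (t : 'S_d) : hmp_param R d := HMPParam
  (\matrix_(i, j) trans Theta (t i) (t j)) (\matrix_(i, c) emis Theta (t i) c)
  (\col_i init Theta (t i) ord0).

Lemma permute_states_stochastic t : stochastic_param R d (permute_states t).
Proof.
have [[M0 M1] [E0 E1] [p0 p1]] := stoTheta.
split; split=> /= i; try (move=> j; rewrite !mxE //).
- rewrite -[RHS](M1 (t i)) [RHS](reindex_inj (@perm_inj _ t)) /=.
  by apply: eq_bigr => j _; rewrite mxE.
- by rewrite -[RHS](E1 (t i)); apply: eq_bigr => j _; rewrite mxE.
- by have := p0 ord0 (t j); rewrite mxE.
- rewrite -[RHS](p1 ord0) [RHS](reindex_inj (@perm_inj _ t)) /=.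
  by apply: eq_bigr => j _; rewrite !mxE.
Qed.

Section Conjugate.
Context (x : 'cV[R]_d) (S : Sigma -> 'M[R]_d) (Q : 'M[R]_d).
Context (Qu : Q \in unitmx) (Q1 : Q *m const_mx 1 = const_mx 1 :> 'cV[R]_d).
Context (xE : x = Q^T *m init Theta) (SE : forall c, S c = invmx Q *m T c *m Q).

Lemma conj_sum : S letter_a + S letter_b = invmx Q *m trans Theta *m Q.
Proof. by rewrite !SE -mulmxDl -mulmxDr (sum_T_mx stoTheta). Qed.

Lemma conj_ratio : S letter_a *m invmx (S letter_a + S letter_b) =
  invmx Q *m O_mx Theta letter_a *m Q.
Proof. by rewrite conj_sum SE; apply: conj_quotient. Qed.

Lemma toC_conj (A : 'M[R]_d) :
  toC (invmx Q *m A *m Q) = invmx (toC Q) *m toC A *m toC Q.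
Proof. by rewrite toC_mul [X in X *m _]toC_mul /toC map_invmx. Qed.

Let lam := toC (col letter_a (emis Theta))^T.

Lemma toC_O_mx : toC (O_mx Theta letter_a) = diag_mx lam.
Proof. exact: map_diag_mx. Qed.

Lemma lam_inj : injective (lam ord0).
Proof. by move=> i j; rewrite !mxE => -[] /emis_inj. Qed.

Lemma conj_regular : regular S.
Proof.
split; first by rewrite conj_sum conj_unitmx.
exists (invmx (toC Q)); first by rewrite unitmx_inv toC_unit.
exists lam; first exact: lam_inj.
by rewrite conj_ratio toC_conj toC_O_mx conj_invmx // toC_unit.
Qed.

(** The inverse of Q is an admissible S: it undoes the conjugation and fixes 1. *)
Lemma infer_hmm_conj_exists : exists M O pi, infer_hmm x S M O pi.
Proof.
have Qcu : toC Q \in unitmx by rewrite toC_unit.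
pose S0 := invmx (toC Q).
exists (invmx S0 *m toC (S letter_a + S letter_b) *m S0).
exists (fun c => invmx S0 *m toC (S c) *m S0 *m
  invmx (invmx S0 *m toC (S letter_a + S letter_b) *m S0)).
exists (S0^T *m toC x), S0; split => //; first by rewrite unitmx_inv.
  rewrite -[RHS](mulKmx Qcu); congr (_ *m _).
  by rewrite -toC_one -toC_mul Q1.
exists lam; rewrite conj_ratio toC_conj toC_O_mx.
exact: conj_invmx.
Qed.

(** W = Q S diagonalizes O_a and fixes 1, so it is a permutation matrix. Thus the output is real,
    even for complex S, and is the given process with relabelled states. *)
Lemma infer_hmm_conj M O pi : infer_hmm x S M O pi ->
  exists2 Theta', represents M O pi Theta' & stochastic_param R d Theta'.
Proof.
move=> [S0 [S0u S01 [mu muE] ME [OE piE]]].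
have Qcu : toC Q \in unitmx by rewrite toC_unit.
have Mcu : toC (trans Theta) \in unitmx by rewrite toC_unit.
pose W := toC Q *m S0.
have Wu : W \in unitmx by rewrite unitmx_mul Qcu.
have W1 : W *m const_mx 1 = const_mx 1 :> 'cV_d.
  by rewrite -mulmxA S01 -toC_one -toC_mul Q1.
have conjW (A : 'M[R]_d) :
    invmx S0 *m toC (invmx Q *m A *m Q) *m S0 = invmx W *m toC A *m W.
  by rewrite toC_conj; apply: conj_conj.
have WD : invmx W *m diag_mx lam *m W = diag_mx mu.
  by rewrite -toC_O_mx -conjW -conj_ratio.
have [s Ws] := diagonalizer_perm_mx lam_inj Wu W1 WD.
have conjs (A : 'M[R]_d) : invmx W *m toC A *m W =
    toC (\matrix_(i, j) A ((s^-1)%g i) ((s^-1)%g j)).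
  by rewrite Ws perm_mx_conj; apply/matrixP => i j; rewrite !mxE.
(* [perm_mx_conj] reads entries through the inverse of s. *)
exists (permute_states (s^-1)%g); last exact: permute_states_stochastic.
have ME' : M = invmx W *m toC (trans Theta) *m W by rewrite ME conj_sum conjW.
split.
- by rewrite ME' conjs.
- move=> c; rewrite OE SE conjW ME' [toC (T_mx _ _)]toC_mul.
  rewrite (conj_quotient _ Wu Mcu) conjs.
  congr (toC _); apply/matrixP => i j; rewrite !mxE.
  by rewrite (inj_eq perm_inj).
- rewrite piE xE toC_mul mulmxA /toC -map_trmx -/(toC _) -trmx_mul -/W Ws.
  rewrite tr_perm_mx -row_permE; apply/matrixP => i j.
  by rewrite !mxE (ord1 j).
Qed.

End Conjugate.

(** The rank test skips every e below d, and at e = d each rejecting branch contradicts one of the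
    preceding lemmas. *)
Lemma identify_hmp_accepts e o : (e <= d)%N -> identify_from d P e o ->
  o <> PrintNoHMP.
Proof.
have dn2 : (d.*2.-1 <= n)%N by rewrite dn uphalf_half -[leqRHS]odd_double_half; case: odd; lia.
move=> + run; elim: run => {e o}.
- by move=> e de ed; move: de; rewrite ltnNge ed.
- move=> e o ed nrc _ IH _; apply: IH; rewrite ltn_neqAle ed andbT.
  by apply/eqP => /rank_condition_hmp.
- move=> e x S o _ /rank_condition_hmp ed; subst e => fin nreg _ _ _.
  have [Q [Qu _ _ SE]] := infer_finitary_hmp stoTheta d0 dn2 fin.
  by case: nreg; apply: conj_regular Qu SE.
- by [].
- move=> e x S M O pi _ /rank_condition_hmp ed; subst e => fin reg hmm nsto _.
  have [Q [Qu Q1 xE SE]] := infer_finitary_hmp stoTheta d0 dn2 fin.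
  by case: nsto; apply: infer_hmm_conj Qu Q1 xE SE _ _ _ hmm.
- move=> e x S _ /rank_condition_hmp ed; subst e => fin reg nhmm _.
  have [Q [Qu Q1 xE SE]] := infer_finitary_hmp stoTheta d0 dn2 fin.
  by case: nhmm; apply: infer_hmm_conj_exists Qu Q1 SE.
Qed.

End GenericAcceptance.

(** * The polynomial cutting out the exceptional set *)

Section GenericityPolynomial.
Context {K : comNzRingType} {d : nat}.
Implicit Types (M : 'M[K]_d) (E : 'M[K]_(d, 2)) (pi : 'cV[K]_d).

(** The value is p(a^k) for a stochastic parametrization and k at most n. The ring is arbitrary so
    that the formula also applies to matrices of indeterminates. *)
Definition letter_a_moment M E pi k : K :=
  (pi^T *m iter k (mulmx (diag_mx (col letter_a E)^T *m M)) (const_mx 1 : 'cV[K]_d)) ord0 ord0.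

(** The middle factor is, up to sign, the discriminant of the probabilities of emitting a. *)
Definition genericity M E pi : K :=
  \det M
  * \prod_i \prod_(j < d | i != j) (E i letter_a - E j letter_a)
  * \det (\matrix_(i < d, j < d) letter_a_moment M E pi (i + j)).

End GenericityPolynomial.

(** Applied to the evaluation morphism, this gives the values of [genericity_mpoly]. *)
Lemma genericity_map (K L : comNzRingType) (f : {rmorphism K -> L}) d
    (M : 'M[K]_d) E pi :
  f (genericity M E pi) = genericity (map_mx f M) (map_mx f E) (map_mx f pi).
Proof.
have momE k : f (letter_a_moment M E pi k) =
    letter_a_moment (map_mx f M) (map_mx f E) (map_mx f pi) k.
  rewrite /letter_a_moment -map_col !map_trmx -map_diag_mx -map_mxM.
  have -> : iter k (mulmx (map_mx f (diag_mx (col letter_a E)^T *m M))) (const_mx 1)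
     = map_mx f (iter k (mulmx (diag_mx (col letter_a E)^T *m M)) (const_mx 1)) :> 'cV_d.
    elim: k => [|k IH] /=; first by rewrite map_const_mx rmorph1.
    by rewrite IH -map_mxM.
  by rewrite -map_mxM [RHS]mxE.
rewrite /genericity !rmorphM /= !det_map_mx; congr (_ * _ * _).
  rewrite rmorph_prod; apply: eq_bigr => i _; rewrite rmorph_prod.
  by apply: eq_bigr => j _; rewrite rmorphB !mxE.
by rewrite -det_map_mx; congr (\det _); apply/matrixP => i j; rewrite !mxE momE.
Qed.

(** * Parameters as points of affine space *)

Section Coordinates.
Context {R : realType} {d : nat}.
Local Notation m := (d * d + d * 2 + d)%N.

(** The shifts of the indices mirror the block layout of [coords]. *)
Definition genericity_mpoly : {mpoly R[m]} := genericity
  (\matrix_(i, j) 'X_(lshift d (lshift (d * 2) (mxvec_index i j))))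
  (\matrix_(i, c) 'X_(lshift d (rshift (d * d) (mxvec_index i c))))
  (\col_i 'X_(rshift (d * d + d * 2) i)).

Lemma peval_genericity (Theta : hmp_param R d) :
  peval genericity_mpoly (coords Theta) =
    genericity (trans Theta) (emis Theta) (init Theta).
Proof.
rewrite /peval /genericity_mpoly.
rewrite (genericity_map (meval (fun i => coords Theta ord0 i))).
congr genericity; apply/matrixP => i j; rewrite mxE mxE /= mevalXU /coords.
- by rewrite !row_mxEl mxvecE.
- by rewrite row_mxEl row_mxEr mxvecE.
- by rewrite row_mxEr mxE (ord1 j).
Qed.

Lemma convex_stochastic : convex_subset (coords @` stochastic_param R d).
Proof.
move=> x y t /andP[t0 t1] [X [[XM0 XM1] [XE0 XE1] [Xp0 Xp1]] <-].
move=> [Y [[YM0 YM1] [YE0 YE1] [Yp0 Yp1]] <-].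
pose mix p q (A B : 'M[R]_(p, q)) := (1 - t) *: A + t *: B.
have mixP p q (A B : 'M[R]_(p, q)) :
    stochastic_mx A -> stochastic_mx B -> stochastic_mx (mix p q A B).
  move=> [A0 A1] [B0 B1]; split=> [i j|i].
    by rewrite !mxE addr_ge0 // mulr_ge0 // subr_ge0.
  under eq_bigr do rewrite !mxE.
  by rewrite big_split /= -!mulr_sumr A1 B1 !mulr1 subrK.
exists (HMPParam (mix _ _ (trans X) (trans Y)) (mix _ _ (emis X) (emis Y))
                 (mix _ _ (init X) (init Y))).
  split; [exact: mixP|exact: mixP|].
  have -> : (mix _ _ (init X) (init Y))^T = mix _ _ (init X)^T (init Y)^T.
    by apply/matrixP => i j; rewrite !mxE.
  exact: mixP.
rewrite /coords /= !scale_row_mx !add_row_mx; congr (row_mx (row_mx _ _) _).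
- by rewrite /mix linearD !linearZ.
- by rewrite /mix linearD !linearZ.
- by rewrite /mix linearD !linearZ.
Qed.

(* A witness of genericity: frozen states with distinct emissions, for which the
   moments are those of a measure with [d] atoms. *)
Lemma generic_exists : (0 < d)%N ->
  exists2 Theta, stochastic_param R d Theta & peval genericity_mpoly (coords Theta) != 0.
Proof.
move=> d0; pose al (s : 'I_d) : R := s%:R / d%:R.
have dR : 0 < d%:R :> R by rewrite ltr0n.
have al01 s : 0 <= al s <= 1.
  by rewrite divr_ge0 ?ler0n //= ler_pdivrMr // mul1r ler_nat ltnW.
have al_inj : injective al.
  move=> s s' /(mulIf (invr_neq0 (lt0r_neq0 dR))) /eqP.
  by rewrite eqr_nat => /eqP; exact: val_inj.
pose E : 'M[R]_(d, 2) := \matrix_(s, c) if c == letter_a then al s else 1 - al s.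
pose p : 'cV[R]_d := const_mx d%:R^-1.
exists (HMPParam 1%:M E p).
  split; split=> /=.
  - by move=> i j; rewrite mxE ler0n.
  - move=> i; rewrite (bigD1 i) //= mxE eqxx big1 ?addr0 // => j.
    by rewrite mxE eq_sym => /negPf ->.
  - move=> i c; rewrite mxE; have /andP[a0 a1] := al01 i.
    by case: ifP => // _; rewrite subr_ge0.
  - by move=> i; rewrite big_ord_recl big_ord1 !mxE /= addrC subrK.
  - by move=> i j; rewrite !mxE invr_ge0 ler0n.
  - move=> i; under eq_bigr do rewrite !mxE.
    by rewrite sumr_const card_ord -[LHS]mulr_natr mulVf // lt0r_neq0.
rewrite peval_genericity /= /genericity det1 mul1r.
pose a : 'rV[R]_d := \row_s al s.
have Ea : diag_mx (col letter_a E)^T *m 1%:M = diag_mx a.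
  by rewrite mulmx1; congr diag_mx; apply/rowP => s; rewrite !mxE.
have momE k : letter_a_moment 1%:M E p k = \sum_s d%:R^-1 * al s ^+ k.
  rewrite /letter_a_moment Ea mxE; apply: eq_bigr => s _; rewrite !mxE.
  congr (_ * _); elim: k => [|k IH]; first by rewrite mxE expr0.
  by rewrite iterS mul_diag_mx mxE IH mxE exprS.
(* The moment matrix of d atoms of weight 1/d is a Vandermonde matrix times its scaled transpose,
   invertible as the atoms are distinct. *)
have -> : \matrix_(i < d, j < d) letter_a_moment 1%:M E p (i + j) =
    Vandermonde d a *m (d%:R^-1 *: (Vandermonde d a)^T).
  apply/matrixP => i j; rewrite !mxE momE; apply: eq_bigr => s _.
  by rewrite !mxE exprD mulrCA.
rewrite det_mulmx detZ det_tr det_Vandermonde.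
have prodn0 : \prod_(i < d) \prod_(j < d | (i < j)%N) (a ord0 j - a ord0 i) != 0.
  apply/prodf_neq0 => i _; apply/prodf_neq0 => j ij.
  by rewrite !mxE subr_eq0 (inj_eq al_inj) eq_sym neq_ltn ij.
rewrite !mulf_neq0 //; last by rewrite expf_neq0 // invr_neq0 // lt0r_neq0.
apply/prodf_neq0 => i _; apply/prodf_neq0 => j ij.
by rewrite !mxE subr_eq0 (inj_eq al_inj).
Qed.

(** Each factor of the polynomial gives one condition; the moments involved have order at most 2d -
    2, hence are probabilities p(a^(i+j)). *)
Lemma generic_conditions n (Theta : hmp_param R d) :
  stochastic_param R d Theta -> (d.*2.-1 <= n)%N ->
  genericity (trans Theta) (emis Theta) (init Theta) != 0 ->
  [/\ trans Theta \in unitmx, injective (fun s => emis Theta s letter_a)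
    & letter_a_hankel n Theta \in unitmx].
Proof.
move=> sto dn; rewrite /genericity !mulf_eq0 !negb_or => /andP[/andP[M0 E0] H0].
split; first by rewrite unitmxE unitfE.
  move=> i j Eij; apply/eqP; apply: contraT => ij.
  move: E0; rewrite (bigD1 i) //= (bigD1 j) //= Eij subrr !mul0r.
  by rewrite eqxx.
rewrite unitmxE unitfE; have -> // : letter_a_hankel n Theta =
  \matrix_(i, j) letter_a_moment (trans Theta) (emis Theta) (init Theta) (i + j).
apply/matrixP => i j; rewrite !mxE prob_hmp //; last first.
  by rewrite size_cat !size_nseq; have := ltn_ord i; have := ltn_ord j; lia.
rewrite /letter_a_moment -mulmxA -nseqD; congr (fun_of_matrix (_ *m _) _ _).
elim: (i + j)%N => [|k IH]; first by rewrite word_mx_nil mul1mx.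
by rewrite /= word_mx_cons -mulmxA IH.
Qed.

End Coordinates.

(** * Assembly of the result *)

Theorem theorem7p1 (R : realType) (n d : nat) (hn : (1 <= n)%N)
    (hd : d = (n.+1)./2) :
  let H := coords @` stochastic_param R d in
  exists N : set 'rV[R]_(d * d + d * 2 + d),
    [/\ algebraic N,
        (zdim (N `&` H) < zdim H)%E,
        (forall Theta : hmp_param R d,
           stochastic_param R d Theta -> ~ N (coords Theta) ->
           (exists o, IdentifyHMP d (hmp_map n Theta) o) /\
           (forall o, IdentifyHMP d (hmp_map n Theta) o ->
              exists (e : nat) (Theta' : hmp_param R e),
                [/\ (1 <= e <= d)%N, o = PrintHMP e Theta',
                    stochastic_param R e Theta'
                  & hmp_map n Theta' = hmp_map n Theta]))
      & (forall P : n.-tuple Sigma -> R,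
           is_distribution P ->
           ~ (exists2 e, (1 <= e <= d)%N & due_to_hmp e P) ->
           (exists o, IdentifyHMP d P o) /\
           (forall o, IdentifyHMP d P o -> o = PrintNoHMP))].
Proof.
move=> H; have d0 : (0 < d)%N by rewrite hd; lia.
have dn : d = uphalf n by [].
have dn1 : (d <= uphalf n)%N by rewrite dn.
have dn2 : (d.*2.-1 <= n)%N by rewrite hd; lia.
have [Theta0 sto0 gen0] := @generic_exists R d d0.
exists [set x | peval (@genericity_mpoly R d) x = 0]; split.
- exists [:: genericity_mpoly]; apply/seteqP; split=> x /=.
    by move=> x0 f; rewrite inE => /eqP ->.
  by apply; rewrite inE.
- apply: (@zdim_lt _ _ _ _ (@genericity_mpoly R d)).
  + by move=> x [].
  + by exists (coords Theta0), Theta0.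
  + exact: convex_stochastic.
  + by move=> x [].
  + by move=> van; move/eqP: gen0; apply; apply: van; exists Theta0.
- move=> Theta sto /eqP; rewrite peval_genericity => gen.
  have [Mu Einj Hu] := generic_conditions sto dn2 gen.
  split; first by apply: identify_exists => //; rewrite prob_hmp_nil // oner_neq0.
  move=> o run; have acc := identify_hmp_accepts sto Mu Einj Hu d0 dn d0 run.
  have [//|[e [Theta' [e1 -> _ sto' eqP]]]] := identify_sound dn1 (ltn0Sn 0) run.
  by exists e, Theta'.
- move=> P [_ P1] nhmp; split.
    by apply: identify_exists => //; rewrite prob_nil P1 oner_neq0.
  move=> o run; have [//|[e [Theta' [e1 _ _ sto' eqP]]]] :=
    identify_sound dn1 (ltn0Sn 0) run.
  by case: nhmp; exists e => //; exists Theta'.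
Qed.
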